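(* There exist absolute constants $0<c_1\le c_2$ and $C>0$ such that the following holds. For every integer $n\ge 1$ and every $L>0$ there is an integer $m_0$ with $1\le m_0\le n$ and $c_1 n^{2/3}\le m_0\le c_2 n^{2/3}$ such that, setting $m=n$ and $\eta=\frac{1}{m_0L}$ (so that $\eta=\Theta\big(\frac{1}{n^{2/3}L}\big)$), the following is true for every dimension $d'\ge1$, all differentiable, possibly non-convex, $L$-smooth functions $f_1,\dots,f_n:\mathbb{R}^{d'}\to\mathbb{R}$ whose average $f=\frac1n\sum_{i=1}^n f_i$ attains its global minimum, every starting vector $x^\phi\in\mathbb{R}^{d'}$ and every integer $S\ge1$: the random output $x$ of the non-convex SVRG algorithm (defined in the context) run with input $(x^\phi,S,m,m_0,\eta)$ satisfies $$\mathbb{E}\big[\|\nabla f(x)\|^2\big]\le C\,\frac{L\,\big(f(x^\phi)-\min_x f(x)\big)}{S\,n^{1/3}} .$$ In other words, for every $\varepsilon>0$, in order to have $\mathbb{E}[\|\nabla f(x)\|^2]\le\varepsilon$ it suffices that the total number of iterations $Sn$ satisfies $$Sn\ \ge\ C\,\frac{n^{2/3}L\big(f(x^\phi)-\min_x f(x)\big)}{\varepsilon}.$$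
   Context: A differentiable function $g:\mathbb{R}^{d'}\to\mathbb{R}$ is $L$-smooth if $\|\nabla g(x)-\nabla g(y)\|\le L\|x-y\|$ for all $x,y$ (Euclidean norm). Weights: $\beta_0=1$ and $\beta_t=(1+\eta L)^{-t}=(1+1/m_0)^{-t}$ for $t=1,\dots,m_0-1$. Non-convex SVRG algorithm. Input: starting vector $x^\phi$, number of epochs $S$, number $m$ of iterations per epoch, subepoch length $m_0$, step length $\eta>0$. 1. Set $x_0^1=x^\phi$. 2. For $s=1,\dots,S$: compute $\widetilde\mu=\nabla f(x_0^s)$. For $k=0,1,\dots,m-1$: pick $i$ uniformly at random in $\{1,\dots,n\}$ (independently of everything else), set $\widetilde\nabla=\nabla f_i(x_k^s)-\nabla f_i(x_0^s)+\widetilde\mu$ and $x_{k+1}^s=x_k^s-\eta\widetilde\nabla$. After these $m$ iterations, pick (independently of everything else) a random $m^s\in\{m,m-1,\dots,m-m_0+1\}$ with probabilities proportional, in this order, to $$\beta_{m_0-1},\ \tfrac{10}{9}\beta_{m_0-1},\ \tfrac{10}{9}(\beta_{m_0-1}+\beta_{m_0-2}),\ \dots,\ \tfrac{10}{9}(\beta_{m_0-1}+\cdots+\beta_1);$$ that is, $m^s=m$ has weight $\beta_{m_0-1}$ and $m^s=m-j$ has weight $\frac{10}{9}\sum_{r=m_0-j}^{m_0-1}\beta_r$ for $1\le j\le m_0-1$. Set $x_0^{s+1}=x_{m^s}^s$. 3. Return $x=x_{t-1}^s$, where the index pair $(s,t)$ is chosen uniformly at random from $\{(s,t):1\le s\le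 S,\ 1\le t\le m^s\}$. The expectation is over all the randomness of the algorithm. An iteration is one execution of the inner loop body, so that there are $Sm$ iterations in total. *)

(* Defs.v *)
From HB Require Import structures.
From mathcomp Require Import all_boot all_order all_algebra.
From mathcomp Require Import all_classical all_reals all_analysis.
Set Implicit Arguments.
Unset Strict Implicit.
Unset Printing Implicit Defensive.
Import Order.TTheory GRing.Theory Num.Theory.
Import numFieldNormedType.Exports.
Local Open Scope ring_scope.

(* The library norm on matrices is the sup norm, hence this definition.  The
   topology, and so [differentiable], is the same for both norms. *)
Definition norm2 (R : realType) (d : nat) (x : 'rV[R]_d) : R :=
  Num.sqrt (\sum_(j < d) x ord0 j ^+ 2).

Definition gradient (R : realType) (d : nat) (g : 'rV[R]_d -> R)
    (x : 'rV[R]_d) : 'rV[R]_d :=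
  \row_(j < d) 'D_(delta_mx ord0 j) g x.

Definition smooth (R : realType) (d : nat) (L : R) (g : 'rV[R]_d -> R) : Prop :=
  (forall x, differentiable g x) /\
  (forall x y, norm2 (gradient g x - gradient g y) <= L * norm2 (x - y)).

Definition average (R : realType) (n d : nat) (f : 'I_n -> 'rV[R]_d -> R)
    (x : 'rV[R]_d) : R :=
  n%:R^-1 * \sum_(i < n) f i x.

Section SVRG.
Variables (R : realType) (n d : nat).
Variable f : 'I_n -> 'rV[R]_d -> R.
Variable eta : R.

(* [x0] is the snapshot at the start of the epoch, [x] the current iterate,
   [i] the sampled index. *)
Definition svrg_step (x0 x : 'rV[R]_d) (i : 'I_n) : 'rV[R]_d :=
  x - eta *: (gradient (f i) x - gradient (f i) x0 + gradient (average f) x0).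

(* x_k of the epoch with snapshot [x0]; [idx] lists the indices sampled at
   iterations 0, 1, 2, etc. *)
Definition svrg_iterate (x0 : 'rV[R]_d) (idx : seq 'I_n) (k : nat) : 'rV[R]_d :=
  foldl (svrg_step x0) x0 (take k idx).

Variables (m m0 S : nat).

(* The random draws of one epoch: the m sampled indices and the offset j such
   that m^s = m - j. *)
Definition epoch_draw : Type := (m.-tuple 'I_n * 'I_m0)%type.

Definition epoch_length (e : epoch_draw) : nat := (m - e.2)%N.

(* The starting point of the epoch that follows the epochs [es]. *)
Definition epoch_start (xphi : 'rV[R]_d) (es : seq epoch_draw) : 'rV[R]_d :=
  foldl (fun x0 (e : epoch_draw) => svrg_iterate x0 e.1 (epoch_length e)) xphi es.

(* All the draws of a run.  Epochs are numbered from 0, and the last component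
   stands for the pair (s, t - 1): it ranges over all of 'I_S * 'I_m, the pairs
   with t > m^s having probability 0 below. *)
Definition svrg_draw : Type := (S.-tuple epoch_draw * ('I_S * 'I_m))%type.

Definition svrg_output (xphi : 'rV[R]_d) (w : svrg_draw) : 'rV[R]_d :=
  let: (es, (s, t)) := w in
  svrg_iterate (epoch_start xphi (take s es)) (tnth es s).1 t.

Definition svrg_beta (t : nat) : R := (1 + m0%:R^-1) ^- t.

Definition offset_weight (j : nat) : R :=
  if j is 0%N then svrg_beta m0.-1
  else 10 / 9 * \sum_(m0 - j <= r < m0) svrg_beta r.

Definition offset_prob (j : 'I_m0) : R :=
  offset_weight j / \sum_(k < m0) offset_weight k.

Definition epoch_prob (e : epoch_draw) : R :=
  (\prod_(k < m) n%:R^-1) * offset_prob e.2.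

(* Uniform over {(s, t) : t <= m^s}, conditionally on the epochs [es]. *)
Definition output_prob (es : S.-tuple epoch_draw) (st : 'I_S * 'I_m) : R :=
  if (st.2 < epoch_length (tnth es st.1))%N
  then (\sum_(s < S) epoch_length (tnth es s))%N%:R^-1 else 0.

Definition svrg_prob (w : svrg_draw) : R :=
  (\prod_(s < S) epoch_prob (tnth w.1 s)) * output_prob w.1 w.2.

Definition svrg_expectation (X : svrg_draw -> R) : R :=
  \sum_(w : svrg_draw) svrg_prob w * X w.

End SVRG.

Definition expected_sq_gradient (R : realType) (n d : nat)
    (f : 'I_n -> 'rV[R]_d -> R) (xphi : 'rV[R]_d) (S m m0 : nat) (eta : R) : R :=
  svrg_expectation (fun w : svrg_draw n m m0 S =>
    norm2 (gradient (average f) (svrg_output f eta xphi w)) ^+ 2).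

Lemma tuple_prod_sum (R : realType) (T : finType) (k : nat) (p : T -> R) :
  \sum_(x : k.-tuple T) \prod_(i < k) p (tnth x i) = (\sum_a p a) ^+ k.
Proof.
rewrite -[in RHS](card_ord k) -[RHS]prodr_const.
rewrite (bigA_distr_bigA (fun _ a => p a)).
rewrite (reindex (fun g : {ffun 'I_k -> T} => [tuple g i | i < k])) /=.
  apply: eq_bigr => g _; apply: eq_bigr => i _; by rewrite tnth_mktuple.
exists (fun x : k.-tuple T => [ffun i => tnth x i]) => x _.
  by apply/ffunP => i; rewrite ffunE tnth_mktuple.
by apply: eq_from_tnth => i; rewrite tnth_mktuple ffunE.
Qed.

Lemma svrg_beta_gt0 (R : realType) (m0 t : nat) : 0 < svrg_beta R m0 t.
Proof. by rewrite /svrg_beta invr_gt0 exprn_gt0// ltr_pwDl// invr_ge0. Qed.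

Lemma offset_weight_ge0 (R : realType) (m0 j : nat) : 0 <= offset_weight R m0 j.
Proof.
case: j => [|j] /=; first exact/ltW/svrg_beta_gt0.
by rewrite mulr_ge0// sumr_ge0// => r _; exact/ltW/svrg_beta_gt0.
Qed.

Lemma sum_offset_weight_gt0 (R : realType) (m0 : nat) : (0 < m0)%N ->
  0 < \sum_(j < m0) offset_weight R m0 j.
Proof.
case: m0 => // m0 _; rewrite big_ord_recl ltr_pwDl ?svrg_beta_gt0//.
by rewrite sumr_ge0// => j _; exact: offset_weight_ge0.
Qed.

Lemma svrg_prob_ge0 (R : realType) (n m m0 S : nat) (w : svrg_draw n m m0 S) :
  0 <= svrg_prob R w.
Proof.
apply: mulr_ge0; last by rewrite /output_prob; case: ifP => // _; rewrite invr_ge0.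
apply: prodr_ge0 => s _; apply: mulr_ge0; first by apply: prodr_ge0 => k _; rewrite invr_ge0.
apply: divr_ge0; first exact: offset_weight_ge0.
by apply: sumr_ge0 => j _; exact: offset_weight_ge0.
Qed.

Lemma sum_svrg_prob (R : realType) (n m m0 S : nat) :
  (0 < n)%N -> (0 < m0 <= m)%N -> (0 < S)%N ->
  \sum_(w : svrg_draw n m m0 S) svrg_prob R w = 1.
Proof.
move=> n0 /andP[m00 m0m] S0.
transitivity (\sum_(es : S.-tuple (epoch_draw n m m0))
   \sum_(st : 'I_S * 'I_m) svrg_prob R (es, st)).
  by rewrite pair_bigA; apply: eq_bigr => -[].
transitivity (\sum_(es : S.-tuple (epoch_draw n m m0))
   \prod_(s < S) epoch_prob R (tnth es s)).
  apply: eq_bigr => es _; rewrite /svrg_prob /= -big_distrr/=.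
  rewrite -[RHS]mulr1; congr (_ * _).
  rewrite /output_prob -big_mkcond/= sumr_const.
  rewrite -[LHS]mulr_natl; set N := (\sum_(s < S) _)%N.
  have -> : #|[pred i : 'I_S * 'I_m | (i.2 < epoch_length (tnth es i.1))%N]| = N.
    rewrite -sum1_card.
    transitivity (\sum_(s < S) \sum_(t < m | (t < epoch_length (tnth es s))%N) 1)%N.
      by rewrite (pair_big_dep xpredT (fun s (t:'I_m) => (t < epoch_length (tnth es s))%N)) /=; apply: eq_bigl => -[].
    apply: eq_bigr => s _.
    have le: (epoch_length (tnth es s) <= m)%N by rewrite /epoch_length leq_subr.
    by rewrite -(big_ord_widen _ (fun=> 1%N) le) sum1_card card_ord.
  rewrite mulfV // pnatr_eq0 -lt0n.
  rewrite {}/N; case: S S0 es => // S' _ es; rewrite big_ord_recl addn_gt0 /epoch_length subn_gt0.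
  by rewrite (leq_trans (ltn_ord _) m0m).
rewrite tuple_prod_sum -[RHS](expr1n _ S); congr (_ ^+ _).
transitivity (\sum_(x : m.-tuple 'I_n) \sum_(j < m0) epoch_prob R (x, j)).
  by rewrite pair_bigA; apply: eq_bigr => -[].
rewrite /epoch_prob /=.
under eq_bigr do rewrite -big_distrr/=.
rewrite -big_distrl /= (@tuple_prod_sum R _ m (fun _ : 'I_n => n%:R^-1)).
rewrite sumr_const card_ord -[_ *+ _]mulr_natl divff ?pnatr_eq0 -?lt0n// expr1n mul1r.
by rewrite -big_distrl/= divff// gt_eqF// sum_offset_weight_gt0.
Qed.

(* Main.v *)
Require Import Defs.
From mathcomp Require Import all_boot all_order all_algebra.
From mathcomp Require Import all_classical all_reals all_analysis.
From mathcomp Require Import ring lra zify.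
Import Order.TTheory GRing.Theory Num.Theory.
Import numFieldNormedType.Exports.
Local Open Scope ring_scope.

(* Within an epoch with snapshot x_0, stopped after M <= m iterations, the
   potential f(x_k) + B (M - k) L |x_k - x_0|^2 decreases in expectation by at
   least (eta / 8) |grad f(x_k)|^2 per iteration: the second moment of the
   estimator is at most |grad f(x_k)|^2 + L^2 |x_k - x_0|^2, and the last term
   is absorbed by the slope B as soon as m_0^3 >= 8 n^2, or m_0 = n when n < 8.
   The potential equals f at both ends, for every M. Since the offset m^s is drawn
   independently of the indices, f decreases in expectation from one snapshot to
   the next whatever the law of the offset, so the precise weights play no role.
   Telescoping over the epochs bounds the expected sum of all |grad f(x_k^s)|^2
   with k < m^s by 8 (f(xphi) - min f) / eta, and the output averages at least
   S (m - m_0 + 1) such terms. *)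

(** * Euclidean inner product and Young's inequality *)

Definition dot {R : realType} {d : nat} (u v : 'rV[R]_d) : R :=
  \sum_(j < d) u ord0 j * v ord0 j.

Lemma dotC {R : realType} {d : nat} (u v : 'rV[R]_d) : dot u v = dot v u.
Proof. by apply: eq_bigr => j _; rewrite mulrC. Qed.

Lemma dotDl {R : realType} {d : nat} (u v w : 'rV[R]_d) :
  dot (u + v) w = dot u w + dot v w.
Proof. by rewrite -big_split; apply: eq_bigr => j _; rewrite mxE mulrDl. Qed.

Lemma dotZl {R : realType} {d : nat} (a : R) (u v : 'rV[R]_d) :
  dot (a *: u) v = a * dot u v.
Proof. by rewrite [RHS]big_distrr; apply: eq_bigr => j _ /=; rewrite mxE mulrA. Qed.

Lemma dotDr {R : realType} {d : nat} (u v w : 'rV[R]_d) :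
  dot u (v + w) = dot u v + dot u w.
Proof. by rewrite dotC dotDl !(dotC u). Qed.

Lemma dotZr {R : realType} {d : nat} (a : R) (u v : 'rV[R]_d) :
  dot u (a *: v) = a * dot u v.
Proof. by rewrite dotC dotZl dotC. Qed.

Lemma dotNr {R : realType} {d : nat} (u v : 'rV[R]_d) :
  dot u (- v) = - dot u v.
Proof. by rewrite -scaleN1r dotZr mulN1r. Qed.

Lemma dotNl {R : realType} {d : nat} (u v : 'rV[R]_d) :
  dot (- u) v = - dot u v.
Proof. by rewrite dotC dotNr dotC. Qed.

Lemma dot0r {R : realType} {d : nat} (u : 'rV[R]_d) : dot u 0 = 0.
Proof. by rewrite -(scale0r (0 : 'rV[R]_d)) dotZr mul0r. Qed.

Lemma dot_sumr {R : realType} {d : nat} {I : finType} (u : 'rV[R]_d)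
    (v : I -> 'rV[R]_d) :
  dot u (\sum_i v i) = \sum_i dot u (v i).
Proof. exact: (big_morph _ (dotDr u) (dot0r u)). Qed.

Lemma dot_ge0 {R : realType} {d : nat} (u : 'rV[R]_d) : 0 <= dot u u.
Proof. by apply: sumr_ge0 => j _; rewrite -expr2 sqr_ge0. Qed.

Lemma sqr_norm2 {R : realType} {d : nat} (u : 'rV[R]_d) :
  norm2 u ^+ 2 = dot u u.
Proof.
rewrite /norm2 sqr_sqrtr; last by apply: sumr_ge0 => j _; exact: sqr_ge0.
by apply: eq_bigr => j _; rewrite expr2.
Qed.

Lemma norm2_ge0 {R : realType} {d : nat} (u : 'rV[R]_d) : 0 <= norm2 u.
Proof. exact: sqrtr_ge0. Qed.

(** Expand the nonnegative quantity [s^-1 |s u - v|^2]. *)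
Lemma dot_young {R : realType} {d : nat} (s : R) (u v : 'rV[R]_d) : 0 < s ->
  2 * dot u v <= s * dot u u + s^-1 * dot v v.
Proof.
move=> s0; have s_neq0 : s != 0 by rewrite gt_eqF.
have E : s^-1 * dot (s *: u - v) (s *: u - v)
    = s * dot u u + s^-1 * dot v v - 2 * dot u v.
  by rewrite !(dotDl, dotDr, dotNl, dotNr, dotZl, dotZr) (dotC v u); field.
have : 0 <= s^-1 * dot (s *: u - v) (s *: u - v).
  by rewrite mulr_ge0 ?invr_ge0 ?dot_ge0// ltW.
by rewrite E; lra.
Qed.

(** * Smooth functions: derivatives along lines and the descent inequality *)

Lemma smooth_dot {R : realType} {d : nat} (L : R) (g : 'rV[R]_d -> R) x y :
  0 < L -> smooth L g ->
  dot (gradient g x - gradient g y) (gradient g x - gradient g y)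
    <= L ^+ 2 * dot (x - y) (x - y).
Proof.
move=> L0 [_ /(_ x y) gL]; rewrite -!sqr_norm2 -exprMn.
by rewrite ler_pXn2r ?nnegrE ?mulr_ge0 ?norm2_ge0// ltW.
Qed.

Lemma derive_gradient {R : realType} {d : nat} (g : 'rV[R]_d -> R) x v :
  differentiable g x -> 'D_v g x = dot (gradient g x) v.
Proof.
move=> dg; rewrite deriveE// [in LHS](row_sum_delta v) linear_sum.
by apply: eq_bigr => j _; rewrite linearZ mxE deriveE// mulrC.
Qed.

Lemma is_derive_line {R : realType} {d : nat} (g : 'rV[R]_d -> R) x v (t : R) :
  differentiable g (x + t *: v) ->
  is_derive t 1 (fun s : R => g (x + s *: v)) (dot (gradient g (x + t *: v)) v).
Proof.
move=> dg; rewrite -derive_gradient//.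
(* The difference quotients of [g] along [v] and of its restriction to the line coincide as
   functions of [h], so derivability and the derivative transfer together. *)
have E : (fun h : R => h^-1 *: ((g \o shift (x + t *: v)) (h *: v) -
      g (x + t *: v))) =
    (fun h : R => h^-1 *: (((fun s : R => g (x + s *: v)) \o shift t) h%:A -
      g (x + t *: v))).
  apply/funext => h /=; congr (_ *: (g _ - _)).
  by rewrite [h%:A]mulr1 scalerDl addrCA.
have -> : 'D_v g (x + t *: v) = 'D_1 (fun s : R => g (x + s *: v)) t.
  by rewrite /derive E.
apply: derivableP; rewrite /derivable -E.
exact: diff_derivable.
Qed.

Lemma smooth_descent {R : realType} {d : nat} (L : R) (g : 'rV[R]_d -> R) x v :
  0 < L -> smooth L g ->
  g (x + v) <= g x + dot (gradient g x) v + L / 2 * dot v v.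
Proof.
(* [h] is [g] along the segment minus the quadratic bound, up to a constant, and [dh] is its
   derivative. The claim is [h 1 <= h 0], which the mean value theorem reduces to [dh t <= 0]. *)
move=> L0 gL; pose h (t : R) := g (x + t *: v) -
  (t * dot (gradient g x) v + L / 2 * dot v v * t ^+ 2).
pose dh (t : R) := dot (gradient g (x + t *: v)) v -
  (dot (gradient g x) v + L * dot v v * t).
have hD (t : R) : is_derive t 1 h (dh t).
  have D := is_derive_line g x v t (gL.1 _).
  apply: is_deriveB.
  rewrite (_ : (fun s : R => _) =
    (id * cst (dot (gradient g x) v) + cst (L / 2 * dot v v) * (id ^+ 2))); last first.
    by apply/funext.
  apply: is_derive_eq; rewrite !scaler0 !add0r /= /GRing.scale /=.
  by field.
have [t t01] : exists2 t, t \in `]0, 1[%R & h 1 - h 0 = dh t * (1 - 0).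
  apply: MVT => [|]; [exact: ltr01|].
  by apply: derivable_within_continuous => t _; have [] := hD t.
rewrite subr0 mulr1 in_itv/= in t01 * => hE.
have {t01}/andP[t0 t1] := t01.
(* Young's inequality with weight [1 / (L t)] replaces Cauchy-Schwarz. *)
have dh0 : dh t <= 0.
  have Lt0 : 0 < (L * t)^-1 by rewrite invr_gt0 mulr_gt0.
  have := dot_young _ (gradient g (x + t *: v) - gradient g x) v Lt0.
  have := smooth_dot L g (x + t *: v) x L0 gL.
  rewrite [_ + _ - x]addrC addKr dotZl dotZr invrK => A B.
  have : (L * t)^-1 * dot (gradient g (x + t *: v) - gradient g x)
     (gradient g (x + t *: v) - gradient g x) <= L * t * dot v v.
    rewrite mulrC ler_pdivrMr ?mulr_gt0//; apply: (le_trans A).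
    by rewrite le_eqVlt; apply/orP; left; apply/eqP; ring.
  move: B; rewrite dotDl dotNl /dh; lra.
move: hE dh0 => <-; rewrite /h scale1r scale0r addr0; lra.
Qed.

Lemma gradient_average {R : realType} {n d : nat} (L : R)
    (f : 'I_n -> 'rV[R]_d -> R) x :
  (forall i, smooth L (f i)) ->
  gradient (average f) x = n%:R^-1 *: \sum_(i < n) gradient (f i) x.
Proof.
move=> fL; apply/rowP => j; rewrite !mxE summxE.
have df i : derivable (f i) x (delta_mx ord0 j).
  exact/diff_derivable/(fL i).1.
have -> : average f = n%:R^-1 *: \sum_(i < n) f i.
  by apply/funext => y; rewrite /average /= fct_sumE.
rewrite deriveZ; last exact: derivable_sum.
by rewrite derive_sum//; congr (_ * _); apply: eq_bigr => i _; rewrite mxE.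
Qed.

(** * Sums over sequences of independent draws *)

Lemma sum_tuple_cons {V : nmodType} {T : finType} (k : nat)
    (F : k.+1.-tuple T -> V) :
  \sum_t F t = \sum_e \sum_(t : k.-tuple T) F [tuple of e :: t].
Proof.
rewrite pair_bigA (reindex (fun p : T * k.-tuple T => [tuple of p.1 :: p.2])) //.
exists (fun t => (thead t, [tuple of behead t])) => [[e t] _|t _] /=.
  by rewrite theadE; congr pair; exact/val_inj.
by rewrite -tuple_eta.
Qed.

(* The run is stopped after [M] of its [k] draws, and [Phi r] is the potential
   with [r] draws left before the stop. *)
Lemma potential_tuple {R : realType} {T : finType} {X : Type} (p : T -> R)
    (step : X -> T -> X) (G : X -> T -> R) (Phi : nat -> X -> R) (k M : nat) x :
  \sum_e p e = 1 ->
  (forall r x, (r < M)%N ->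
    \sum_e p e * (Phi r (step x e) + G x e) <= Phi r.+1 x) ->
  (forall e, 0 <= p e) -> (M <= k)%N ->
  \sum_(t : k.-tuple T) (\prod_(i < k) p (tnth t i)) *
    (Phi 0 (foldl step x (take M t)) +
     \sum_(i < k | (i < M)%N) G (foldl step x (take i t)) (tnth t i))
  <= Phi M x.
Proof.
(* Induction on the number of draws, conditioning on the first draw [e]; the induction hypothesis is
   used from the state [step x e]. *)
move=> p1 + p0; elim: k M x => [|k IH] [|M] x hM Mk //.
- under eq_bigr do rewrite take0 /= big_ord0 [in X in _ * X]big_ord0 mul1r addr0.
  by rewrite sumr_const card_tuple expn0.
- under eq_bigr do rewrite take0 /= [in X in _ * X]big_pred0// addr0.
  by rewrite -big_distrl /= tuple_prod_sum p1 expr1n mul1r.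
rewrite sum_tuple_cons; apply: le_trans (hM _ _ (ltnSn M)).
apply: ler_sum => e _.
(* The gain of the first step does not depend on the later draws, whose total mass is 1, so it can
   be spread over them. *)
have Gx : G x e = \sum_(t : k.-tuple T) (\prod_(i < k) p (tnth t i)) * G x e.
  by rewrite -big_distrl /= tuple_prod_sum p1 expr1n mul1r.
rewrite [X in _ <= p e * (_ + X)]Gx.
rewrite mulrDr [X in _ + X]big_distrr /=.
have {}hM r x0 : (r < M)%N ->
    \sum_e0 p e0 * (Phi r (step x0 e0) + G x0 e0) <= Phi r.+1 x0.
  by move=> /ltnW; exact: hM.
have := IH M (step x e) hM Mk; move=> /(ler_wpM2l (p0 e)).
rewrite big_distrr /= -(lerD2r (\sum_(t : k.-tuple T)
  p e * (\prod_(i < k) p (tnth t i) * G x e))).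
apply: le_trans; rewrite -big_split /= le_eqVlt; apply/orP; left; apply/eqP.
apply: eq_bigr => t _.
have tS i : tnth [tuple of e :: t] (lift ord0 i) = tnth t i.
  by rewrite !(tnth_nth e).
have -> : \sum_(i < k.+1 | (i < M.+1)%N)
      G (foldl step x (take i (e :: t))) (tnth [tuple of e :: t] i) =
    G x e + \sum_(i < k | (i < M)%N)
      G (foldl step (step x e) (take i t)) (tnth t i).
  rewrite big_mkcond big_ord_recl tnth0 -big_mkcond /=; congr (_ + _).
  by apply: eq_bigr => i _; rewrite tS.
have -> : \prod_(i < k.+1) p (tnth [tuple of e :: t] i) =
    p e * \prod_(i < k) p (tnth t i).
  by rewrite big_ord_recl tnth0; congr (_ * _); apply: eq_bigr => i _; rewrite tS.
ring.
Qed.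

(** * Averages over the sampled index, and one step of SVRG *)

Definition mean {R : realType} {n : nat} (F : 'I_n -> R) : R :=
  n%:R^-1 * \sum_(i < n) F i.

Lemma meanD {R : realType} {n : nat} (F G : 'I_n -> R) :
  mean (fun i => F i + G i) = mean F + mean G.
Proof. by rewrite /mean big_split mulrDr. Qed.

Lemma meanZ {R : realType} {n : nat} (a : R) (F : 'I_n -> R) :
  mean (fun i => a * F i) = a * mean F.
Proof. by rewrite /mean -big_distrr mulrCA. Qed.

Lemma mean_const {R : realType} {n : nat} (a : R) : (0 < n)%N ->
  mean (fun _ : 'I_n => a) = a.
Proof.
move=> n0; rewrite /mean sumr_const card_ord -[X in _ * X]mulr_natl mulrA.
by rewrite mulVf ?mul1r// pnatr_eq0 -lt0n.
Qed.

Lemma ler_mean {R : realType} {n : nat} (F G : 'I_n -> R) :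
  (forall i, F i <= G i) -> mean F <= mean G.
Proof. by move=> FG; rewrite ler_wpM2l ?invr_ge0//; apply: ler_sum. Qed.

Lemma mean_dotr {R : realType} {n d : nat} (u : 'rV[R]_d)
    (v : 'I_n -> 'rV[R]_d) :
  mean (fun i => dot u (v i)) = dot u (n%:R^-1 *: \sum_(i < n) v i).
Proof. by rewrite dotZr dot_sumr. Qed.

(** Average the descent inequalities of the [f i]: both sides are linear in the function. *)
Lemma average_descent {R : realType} {n d : nat} (L : R)
    (f : 'I_n -> 'rV[R]_d -> R) x v :
  (0 < n)%N -> 0 < L -> (forall i, smooth L (f i)) ->
  average f (x + v) <=
    average f x + dot (gradient (average f) x) v + L / 2 * dot v v.
Proof.
move=> n0 L0 fL; rewrite (gradient_average L)// dotC -mean_dotr.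
rewrite -(@mean_const R n (L / 2 * dot v v))// -!meanD.
by apply: ler_mean => i; rewrite dotC; apply: smooth_descent.
Qed.

(** The variance of [xi + w] is that of [xi], hence at most the second moment of [xi]. *)
Lemma mean_sq_shift {R : realType} {n d : nat} (xi : 'I_n -> 'rV[R]_d) w :
  (0 < n)%N ->
  mean (fun i => dot (xi i + w) (xi i + w)) <=
    dot (n%:R^-1 *: \sum_(i < n) xi i + w) (n%:R^-1 *: \sum_(i < n) xi i + w) +
    mean (fun i => dot (xi i) (xi i)).
Proof.
move=> n0; set xbar := _ *: _.
have -> : (fun i => dot (xi i + w) (xi i + w)) =
    (fun i => dot (xi i) (xi i) + (2 * dot w (xi i) + dot w w)).
  by apply/funext => i; rewrite !(dotDl, dotDr) (dotC (xi i) w); ring.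
rewrite 2!meanD meanZ mean_dotr -/xbar mean_const//.
rewrite !(dotDl, dotDr) (dotC xbar w).
have := dot_ge0 xbar; lra.
Qed.

(** Here [a] stands for [eta * L], [p] is a weight in Young's inequality, and [b'] and [b] are the
    coefficients of the squared distance to the snapshot before and after the step. *)
Lemma svrg_step_potential {R : realType} {n d : nat} (L a p b b' : R)
    (f : 'I_n -> 'rV[R]_d -> R) x0 x :
  (0 < n)%N -> 0 < L -> (forall i, smooth L (f i)) ->
  0 < a -> 0 < p -> 0 <= b ->
  a ^+ 2 / 2 + b * (1 + p + a ^+ 2) <= b' ->
  a / 2 + b * (1 + p^-1) * a <= 7 / 8 ->
  mean (fun i => let y := svrg_step f (a / L) x0 x i in
     average f y + b * L * dot (y - x0) (y - x0)) +
    a / L / 8 * dot (gradient (average f) x) (gradient (average f) x)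
  <= average f x + b' * L * dot (x - x0) (x - x0).
Proof.
move=> n0 L0 fL a0 p0 b0 hD hG; set eta := a / L; set g := gradient _ _.
have eta0 : 0 < eta by rewrite divr_gt0.
pose xi i := gradient (f i) x - gradient (f i) x0.
pose g0 := gradient (average f) x0.
pose v i := xi i + g0.
set e := x - x0; set D := dot e e; set G := dot g g.
pose W := mean (fun i => dot (v i) (v i)).
have xibar : n%:R^-1 *: \sum_(i < n) xi i = g - g0.
  by rewrite big_split/= sumrN scalerDr scalerN /g /g0 !(gradient_average L).
(* [W] is the second moment of the estimator [v]. The shift by [g0] recentres [xi] at [g], and
   smoothness bounds each [xi i]. *)
have WE : W <= G + L ^+ 2 * D.
  apply: (le_trans (mean_sq_shift xi g0 n0)); rewrite xibar subrK lerD2l.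
  rewrite -[leRHS](@mean_const R n)//.
  by apply: ler_mean => i; exact: smooth_dot.
have vbar : n%:R^-1 *: \sum_(i < n) v i = g.
  rewrite big_split/= scalerDr xibar sumr_const card_ord -(scaler_nat n g0) scalerA.
  by rewrite mulVf ?scale1r ?subrK// pnatr_eq0 -lt0n.
have step i : svrg_step f eta x0 x i = x + - eta *: v i.
  by rewrite /svrg_step scaleNr.
have sq u w : dot (u + - eta *: w) (u + - eta *: w) =
    dot u u - 2 * eta * dot u w + eta ^+ 2 * dot w w.
  by rewrite !(dotDl, dotDr, dotZl, dotZr) (dotC w u); ring.
have descent : mean (fun i => let y := svrg_step f eta x0 x i in
     average f y + b * L * dot (y - x0) (y - x0)) <=
   average f x - eta * G + L * eta ^+ 2 / 2 * W +
   b * L * (D - 2 * eta * dot e g + eta ^+ 2 * W).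
  have -> : average f x - eta * G + L * eta ^+ 2 / 2 * W +
      b * L * (D - 2 * eta * dot e g + eta ^+ 2 * W) =
    mean (fun i => - eta * dot g (v i) + (- (2 * b * L * eta) * dot e (v i) +
      ((L * eta ^+ 2 / 2 + b * L * eta ^+ 2) * dot (v i) (v i) +
       (average f x + b * L * D)))).
    by rewrite 3!meanD 3!meanZ !mean_dotr mean_const// vbar -/G -/W; ring.
  apply: ler_mean => i /=; rewrite step.
  have := average_descent L f x (- eta *: v i) n0 L0 fL.
  rewrite -/g [x + _ - x0]addrAC -/e sq !dotZr dotZl -/D; lra.
(* The cross term of the new squared distance is split between [D], absorbed by the slope [b' - b],
   and [G], absorbed by the decrease of [f]. *)
have young : - (2 * eta * dot e g) <= p * D + p^-1 * (eta ^+ 2 * G).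
  have := dot_young p e (- eta *: g) p0.
  by rewrite !(dotZl, dotZr) -/G -/D; lra.
have bL0 : 0 <= b * L by rewrite mulr_ge0// ltW.
have {}young := ler_wpM2l bL0 young.
have {}WE : (L * eta ^+ 2 / 2 + b * L * eta ^+ 2) * W <=
    (L * eta ^+ 2 / 2 + b * L * eta ^+ 2) * (G + L ^+ 2 * D).
  by rewrite ler_wpM2l// addr_ge0// mulr_ge0// ?sqr_ge0// mulr_ge0// ?sqr_ge0 // ltW.
have {}hG : eta * G * (a / 2 + b * (1 + p^-1) * a) <= eta * G * (7 / 8).
  by rewrite ler_wpM2l// mulr_ge0 ?dot_ge0// ltW.
have {}hD : L * D * (a ^+ 2 / 2 + b * (1 + p + a ^+ 2)) <= L * D * b'.
  by rewrite ler_wpM2l// mulr_ge0 ?dot_ge0// ltW.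
(* Once [a] is replaced by [eta * L], the claim is the sum of [descent], [young], [WE], [hG] and
   [hD]. *)
have aE : a = eta * L by rewrite /eta divfK// gt_eqF.
move: descent young WE hG hD; rewrite {}aE; move: (p^-1) => q; lra.
Qed.

(** * One epoch, the whole run and the random output *)

Lemma epoch_prob_ge0 {R : realType} {n m m0 : nat} (e : epoch_draw n m m0) :
  0 <= epoch_prob R e.
Proof.
apply: mulr_ge0; first by apply: prodr_ge0 => k _; rewrite invr_ge0.
by rewrite divr_ge0 ?offset_weight_ge0// sumr_ge0// => j _; exact: offset_weight_ge0.
Qed.

Lemma sum_offset_prob (R : realType) (m0 : nat) : (0 < m0)%N ->
  \sum_(j < m0) offset_prob R j = 1.
Proof. by move=> m00; rewrite -big_distrl/= divff// gt_eqF// sum_offset_weight_gt0. Qed.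

Lemma sum_uniform (R : realType) (n : nat) : (0 < n)%N ->
  \sum_(i < n) n%:R^-1 = 1 :> R.
Proof.
by move=> n0; rewrite sumr_const card_ord -[LHS]mulr_natl divff// pnatr_eq0 -lt0n.
Qed.

(** By independence, one may average over the indices first, with the offset fixed. *)
Lemma sum_epoch_draw {R : realType} {n m m0 : nat}
    (F : epoch_draw n m m0 -> R) :
  \sum_e epoch_prob R e * F e =
  \sum_j offset_prob R j *
    \sum_(t : m.-tuple 'I_n) (\prod_(k < m) n%:R^-1) * F (t, j).
Proof.
transitivity (\sum_(t : m.-tuple 'I_n) \sum_(j < m0)
    epoch_prob R (t, j) * F (t, j)).
  by rewrite pair_bigA; apply: eq_bigr => -[].
rewrite exchange_big; apply: eq_bigr => j _; rewrite [RHS]big_distrr /=.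
by apply: eq_bigr => t _; rewrite /epoch_prob /=; ring.
Qed.

Lemma sum_epoch_prob (R : realType) (n m m0 : nat) : (0 < n)%N -> (0 < m0)%N ->
  \sum_(e : epoch_draw n m m0) epoch_prob R e = 1.
Proof.
move=> n0 m00; have := @sum_epoch_draw R n m m0 (fun=> 1).
under eq_bigr do rewrite mulr1; move=> ->.
transitivity (\sum_(j < m0) offset_prob R j); last exact: sum_offset_prob.
apply: eq_bigr => j _; under eq_bigr do rewrite mulr1.
by rewrite (@tuple_prod_sum R _ m (fun=> n%:R^-1)) sum_uniform// expr1n mulr1.
Qed.

(** Apply [potential_tuple] with one draw per iteration. With [r] iterations left after a step,
    [svrg_step_potential] is used with [b = B r] and [b' = B (r + 1)]; both of its conditions are
    tightest at [r = m - 1], which gives the two hypotheses here. *)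
Lemma svrg_epoch_descent {R : realType} {n d m : nat} (L a p B : R)
    (f : 'I_n -> 'rV[R]_d -> R) x0 M :
  (0 < n)%N -> 0 < L -> (forall i, smooth L (f i)) ->
  0 < a -> 0 < p -> 0 <= B ->
  a ^+ 2 / 2 + B * (m%:R - 1) * (p + a ^+ 2) <= B ->
  a / 2 + B * (m%:R - 1) * (1 + p^-1) * a <= 7 / 8 ->
  (M <= m)%N ->
  \sum_(t : m.-tuple 'I_n) (\prod_(k < m) n%:R^-1) *
    (average f (svrg_iterate f (a / L) x0 t M) + a / L / 8 *
     \sum_(k < m | (k < M)%N)
       norm2 (gradient (average f) (svrg_iterate f (a / L) x0 t k)) ^+ 2)
  <= average f x0.
Proof.
move=> n0 L0 fL a0 p0 B0 hD hG Mm; set eta := a / L.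
pose Phi (r : nat) x := average f x + B * r%:R * L * dot (x - x0) (x - x0).
pose G x (_ : 'I_n) := eta / 8 * norm2 (gradient (average f) x) ^+ 2.
have hPhi r x : (r < M)%N ->
    \sum_(i < n) n%:R^-1 * (Phi r (svrg_step f eta x0 x i) + G x i)
    <= Phi r.+1 x.
  move=> rM; rewrite -big_distrr /= -/(mean _) meanD {2}/mean -/(mean _).
  rewrite /G mean_const// sqr_norm2.
  have rm : r%:R <= m%:R - 1 :> R.
    by rewrite lerBrDr natr1 ler_nat (leq_trans rM).
  have r0 : 0 <= r%:R :> R by [].
  apply: (@svrg_step_potential R n d L a p) => //.
  - by rewrite mulr_ge0.
  - rewrite -[r.+1%:R]natr1.
    have : B * r%:R * (p + a ^+ 2) <= B * (m%:R - 1) * (p + a ^+ 2).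
      by rewrite ler_wpM2r ?ler_wpM2l// addr_ge0 ?sqr_ge0// ltW.
    lra.
  - apply: le_trans hG; rewrite lerD2l ler_wpM2r ?(ltW a0)//.
    by rewrite ler_wpM2r ?ler_wpM2l// addr_ge0// invr_ge0 ltW.
have := @potential_tuple R 'I_n _ (fun=> n%:R^-1) (svrg_step f eta x0) G Phi m M
  x0 (sum_uniform R n n0) hPhi _ Mm.
rewrite {2}/Phi subrr dot0r mulr0 addr0 => H.
apply: le_trans (H _) => [|i]; last by rewrite invr_ge0.
rewrite le_eqVlt; apply/orP; left; apply/eqP; apply: eq_bigr => t _.
by rewrite /Phi mulr0 !mul0r addr0 /G -big_distrr.
Qed.

(** Apply [potential_tuple] again, now with one draw per epoch and the potential [average f] at
    every stage. *)
Lemma svrg_run_descent {R : realType} {n d m m0 S : nat} (L a p B : R)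
    (f : 'I_n -> 'rV[R]_d -> R) xphi :
  (0 < n)%N -> 0 < L -> (forall i, smooth L (f i)) ->
  0 < a -> 0 < p -> 0 <= B ->
  a ^+ 2 / 2 + B * (m%:R - 1) * (p + a ^+ 2) <= B ->
  a / 2 + B * (m%:R - 1) * (1 + p^-1) * a <= 7 / 8 ->
  (0 < m0)%N ->
  \sum_(es : S.-tuple (epoch_draw n m m0))
    (\prod_(s < S) epoch_prob R (tnth es s)) *
    (average f (epoch_start f (a / L) xphi es) + a / L / 8 *
     \sum_(s < S) \sum_(k < m | (k < epoch_length (tnth es s))%N)
       norm2 (gradient (average f)
         (svrg_iterate f (a / L) (epoch_start f (a / L) xphi (take s es))
            (tnth es s).1 k)) ^+ 2)
  <= average f xphi.
Proof.
move=> n0 L0 fL a0 p0 B0 hD hG m00; set eta := a / L.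
pose G x (e : epoch_draw n m m0) := eta / 8 *
  \sum_(k < m | (k < epoch_length e)%N)
    norm2 (gradient (average f) (svrg_iterate f eta x e.1 k)) ^+ 2.
pose step x (e : epoch_draw n m m0) := svrg_iterate f eta x e.1 (epoch_length e).
have hPhi (r : nat) x : (r < S)%N ->
    \sum_e epoch_prob R e * (average f (step x e) + G x e) <= average f x.
  move=> _; rewrite sum_epoch_draw.
  have -> : average f x = \sum_(j < m0) offset_prob R j * average f x.
    by rewrite -big_distrl /= sum_offset_prob// mul1r.
  apply: ler_sum => j _; rewrite ler_wpM2l//.
    by rewrite divr_ge0 ?offset_weight_ge0// sumr_ge0// => k _; exact: offset_weight_ge0.
  exact: (@svrg_epoch_descent R n d m L a p B f x (m - j)%N n0 L0 fL a0 p0 B0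
    hD hG (leq_subr _ _)).
have := @potential_tuple R _ _ (@epoch_prob R n m m0) step G
  (fun _ => average f) S S xphi (sum_epoch_prob R n m m0 n0 m00) hPhi
  epoch_prob_ge0 (leqnn S).
apply: le_trans; rewrite le_eqVlt; apply/orP; left; apply/eqP.
apply: eq_bigr => es _; rewrite take_oversize ?size_tuple//.
congr (_ * (_ + _)); rewrite big_distrr /=.
by apply: eq_bigl => s; rewrite ltn_ord.
Qed.

(** The number of admissible output pairs is random; it is replaced by its lower bound [K] for each
    fixed run of epochs, before taking expectations. *)
Lemma expected_sq_gradient_le {R : realType} {n d m m0 S : nat} (L a p B : R)
    (f : 'I_n -> 'rV[R]_d -> R) xphi xmin :
  (0 < n)%N -> 0 < L -> (forall i, smooth L (f i)) ->
  (forall x, average f xmin <= average f x) ->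
  0 < a -> 0 < p -> 0 <= B ->
  a ^+ 2 / 2 + B * (m%:R - 1) * (p + a ^+ 2) <= B ->
  a / 2 + B * (m%:R - 1) * (1 + p^-1) * a <= 7 / 8 ->
  (0 < m0 <= m)%N -> (0 < S)%N ->
  expected_sq_gradient f xphi S m m0 (a / L) <=
    8 * L * (average f xphi - average f xmin) / (a * (S%:R * (m - m0).+1%:R)).
Proof.
move=> n0 L0 fL fmin a0 p0 B0 hD hG /andP[m00 m0m] S0.
set eta := a / L; set Delta := _ - _.
have eta0 : 0 < eta by rewrite divr_gt0.
pose X (es : S.-tuple (epoch_draw n m m0)) (s : 'I_S) (k : 'I_m) :=
  norm2 (gradient (average f)
     (svrg_iterate f eta (epoch_start f eta xphi (take s es))
        (tnth es s).1 k)) ^+ 2.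
pose T (es : S.-tuple (epoch_draw n m m0)) :=
  \sum_(s < S) \sum_(k < m | (k < epoch_length (tnth es s))%N) X es s k.
pose P (es : S.-tuple (epoch_draw n m m0)) :=
  \prod_(s < S) epoch_prob R (tnth es s).
have P0 es : 0 <= P es by apply: prodr_ge0 => s _; exact: epoch_prob_ge0.
set K := S%:R * (m - m0).+1%:R : R.
have K0 : 0 < K by rewrite mulr_gt0// ltr0n.
have sumT : \sum_es P es * T es <= 8 / eta * Delta.
  have := svrg_run_descent L a p B f xphi n0 L0 fL a0 p0 B0 hD hG m00 (S := S).
  rewrite -/eta => H.
  have {}H : average f xmin + eta / 8 * (\sum_es P es * T es) <= average f xphi.
    have sumP : \sum_es P es = 1.
      by rewrite /P tuple_prod_sum sum_epoch_prob// expr1n.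
    apply: le_trans H.
    rewrite -[average f xmin]mul1r -[X in X * average f xmin]sumP.
    rewrite big_distrl big_distrr -big_split /=; apply: ler_sum => es _.
    by rewrite (mulrCA (eta / 8)) -mulrDr ler_wpM2l ?P0// lerD2r.
  rewrite mulrAC ler_pdivlMr// /Delta; lra.
(* The offset is at most [m0 - 1], so every epoch contributes at least [m - m0 + 1] pairs. *)
have KN (es : S.-tuple (epoch_draw n m m0)) :
    K <= (\sum_(s < S) epoch_length (tnth es s))%N%:R.
  rewrite /K -natrM ler_nat -[S in leqLHS]card_ord -sum_nat_const.
  apply: leq_sum => s _; rewrite /epoch_length.
  by move: (tnth es s).2 => j; rewrite ltn_sub2l// (leq_trans (ltn_ord j)).
have expE : expected_sq_gradient f xphi S m m0 eta <= K^-1 * \sum_es P es * T es.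
  have -> : expected_sq_gradient f xphi S m m0 eta =
      \sum_(es : S.-tuple (epoch_draw n m m0)) \sum_(sk : 'I_S * 'I_m)
        P es * (output_prob R es sk * X es sk.1 sk.2).
    by rewrite pair_bigA; apply: eq_bigr => -[es [s k]] _; rewrite mulrA.
  rewrite big_distrr; apply: ler_sum => es _ /=.
  rewrite -big_distrr /= mulrCA ler_wpM2l ?P0//.
  have -> : \sum_(sk : 'I_S * 'I_m) output_prob R es sk * X es sk.1 sk.2 =
      \sum_(s < S) \sum_(k < m) output_prob R es (s, k) * X es s k.
    by rewrite pair_bigA; apply: eq_bigr => -[].
  rewrite /T big_distrr; apply: ler_sum => s _ /=.
  rewrite big_distrr /= [leRHS]big_mkcond; apply: ler_sum => k _ /=.
  rewrite /output_prob /=; case: ifP => _; last by rewrite mul0r.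
  by rewrite ler_wpM2r ?sqr_ge0// lef_pV2 ?posrE// (lt_le_trans K0).
apply: (le_trans expE); rewrite -ler_pdivlMl ?invr_gt0// invrK.
apply: (le_trans sumT); rewrite le_eqVlt; apply/orP; left; apply/eqP.
by rewrite /eta; field; rewrite !gt_eqF.
Qed.

(** * Choice of the subepoch length and of the potential's parameters *)

Lemma least_cube_root (n : nat) : (8 <= n)%N ->
  exists m0, [/\ (8 <= m0 <= n)%N, (8 * n ^ 2 <= m0 ^ 3)%N &
                 (m0.-1 ^ 3 < 8 * n ^ 2)%N].
Proof.
(* [m0] is the ceiling of [2 n^(2/3)]; [n] itself is a candidate because [n >= 8]. *)
move=> n8; have nP : (8 * n ^ 2 <= n ^ 3)%N by rewrite (expnS n 2) leq_mul2r n8 orbT.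
case: (ex_minnP (ex_intro (fun m => 8 * n ^ 2 <= m ^ 3)%N n nP)) => m0 lo min.
have m08 : (8 <= m0)%N.
  rewrite -(@leq_exp2r _ _ 3)//; apply: leq_trans lo.
  by rewrite (expnS 8 2) leq_mul2l leq_exp2r.
exists m0; split=> //; first by rewrite m08 min.
by rewrite ltnNge; apply/negP => /min; lia.
Qed.

(* [p] is the weight in Young's inequality for one step, [B] the slope of the
   potential. The first condition holds with equality for this choice of [B];
   the second one reduces to [0 <= (3 n - 7) (7 n - 16)], whose roots lie
   between 2 and 3. *)
Lemma parameters_full_subepoch (R : realType) (n : nat) : (0 < n)%N ->
  let a := n%:R^-1 : R in
  exists p B : R, [/\ 0 < p, 0 <= B,
    a ^+ 2 / 2 + B * (n%:R - 1) * (p + a ^+ 2) <= B &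
    a / 2 + B * (n%:R - 1) * (1 + p^-1) * a <= 7 / 8].
Proof.
move=> n0 a; have x0 : 0 < n%:R :> R by rewrite ltr0n.
have roots : 0 <= (3 * n%:R - 7) * (7 * n%:R - 16) :> R.
  have [n2|n3] := leqP n 2.
    have h : n%:R <= 2 :> R by rewrite ler_nat.
    by rewrite mulr_le0 //; lra.
  have h : 3 <= n%:R :> R by rewrite ler_nat.
  by rewrite mulr_ge0//; lra.
rewrite /a; move: (n%:R : R) x0 roots => x x0 roots.
have N0 : 0 < x ^+ 2 - x + 4.
  have := sqr_ge0 (x - 1 / 2); lra.
exists (3 / (4 * x)), (2 / (x ^+ 2 - x + 4)); split.
- by rewrite divr_gt0// mulr_gt0.
- by rewrite divr_ge0// ltW.
- rewrite le_eqVlt; apply/orP; left; apply/eqP.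
  by field; rewrite !gt_eqF.
- rewrite -subr_ge0.
  have -> : 7 / 8 - (x^-1 / 2 + 2 / (x ^+ 2 - x + 4) * (x - 1) *
      (1 + (3 / (4 * x))^-1) * x^-1) =
    (3 * x - 7) * (7 * x - 16) / (24 * (x ^+ 2 - x + 4)).
    by field; rewrite !gt_eqF.
  by rewrite divr_ge0// mulr_ge0// ltW.
Qed.

Lemma parameters_cube_root_subepoch (R : realType) (n m0 : nat) : (8 <= n)%N ->
  (8 <= m0)%N -> (8 * n ^ 2 <= m0 ^ 3)%N ->
  let a := m0%:R^-1 : R in
  exists p B : R, [/\ 0 < p, 0 <= B,
    a ^+ 2 / 2 + B * (n%:R - 1) * (p + a ^+ 2) <= B &
    a / 2 + B * (n%:R - 1) * (1 + p^-1) * a <= 7 / 8].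
Proof.
move=> n8 m08 lo a.
have n0 : 0 < n%:R :> R by rewrite ltr0n (leq_trans _ n8).
have m00 : 0 < m0%:R :> R by rewrite ltr0n (leq_trans _ m08).
have a0 : 0 < a by rewrite invr_gt0.
have an3 : 8 * n%:R ^+ 2 * a ^+ 3 <= 1.
  rewrite /a exprVn ler_pdivrMr ?mul1r ?exprn_gt0//.
  by rewrite -!natrX -natrM ler_nat.
(* This is [8 n <= m0^2], checked after cubing: [m0^6 >= 64 n^4 >= 512 n^3]. *)
have an2 : 8 * n%:R * a ^+ 2 <= 1.
  rewrite /a exprVn ler_pdivrMr ?mul1r ?exprn_gt0//.
  rewrite -natrX -natrM ler_nat -(@leq_exp2r _ _ 3)// -expnM (mulnC 2) expnM.
  apply: (@leq_trans ((8 * n ^ 2) ^ 2)); last by rewrite leq_exp2r.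
  have -> : ((8 * n) ^ 3 = 8 * (64 * n ^ 3))%N by ring.
  have -> : ((8 * n ^ 2) ^ 2 = n * (64 * n ^ 3))%N by ring.
  by rewrite leq_mul2r n8 orbT.
have a8 : a <= 1 / 8.
  by rewrite /a ler_pdivlMr// mulrC ler_pdivrMr// mul1r ler_nat.
(* This [p] gives [(n - 1) p <= 1/2], and [an2] gives [(n - 1) a^2 <= 1/8]; the factor 4/3 solves
   [1/2 + 5/8 c = c]. The second condition then has left side at most [1/16 + 1/3]. *)
exists (2 * n%:R)^-1, (4 / 3 * a ^+ 2).
have a2 : 0 <= a ^+ 2 by rewrite sqr_ge0.
have n1 : 0 <= n%:R - 1 :> R by rewrite subr_ge0 ler1n (leq_trans _ n8).
split.
- by rewrite invr_gt0 mulr_gt0.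
- by rewrite mulr_ge0.
- have A : (n%:R - 1) * (2 * n%:R)^-1 <= 1 / 2 :> R.
    rewrite ler_pdivrMr ?mulr_gt0//; lra.
  have B : (n%:R - 1) * a ^+ 2 <= 1 / 8 by lra.
  have C : a ^+ 2 * ((n%:R - 1) * (2 * n%:R)^-1 + (n%:R - 1) * a ^+ 2)
      <= a ^+ 2 * (5 / 8) by rewrite ler_wpM2l//; lra.
  by move: (2 * n%:R)^-1 C => q; lra.
- rewrite invrK.
  have : a ^+ 3 * ((n%:R - 1) * (1 + 2 * n%:R)) <= a ^+ 3 * (2 * n%:R ^+ 2).
    by rewrite ler_wpM2l ?exprn_ge0 ?(ltW a0)//; lra.
  lra.
Qed.

(** The cube bounds encode [n^(2/3) <= m0 <= 3 n^(2/3)] in integers; the third bound ensures that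
    each epoch keeps at least [n / 64] eligible iterations. *)
Lemma subepoch_length_exists (R : realType) (n : nat) : (0 < n)%N ->
  exists m0,
  [/\ (0 < m0 <= n)%N, (n ^ 2 <= m0 ^ 3 <= 27 * n ^ 2)%N,
      (n <= 64 * (n - m0).+1)%N &
  let a := m0%:R^-1 : R in
  exists p B : R, [/\ 0 < p, 0 <= B,
    a ^+ 2 / 2 + B * (n%:R - 1) * (p + a ^+ 2) <= B &
    a / 2 + B * (n%:R - 1) * (1 + p^-1) * a <= 7 / 8]].
Proof.
move=> n0; have [n8|n8] := ltnP n 8.
  exists n; split=> //; last by exact: parameters_full_subepoch.
  - by rewrite n0 /=.
  - apply/andP; split; first by rewrite leq_pexp2l.
    by rewrite (expnS n 2) leq_mul2r (leq_trans (ltnW n8)) ?orbT.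
  - by rewrite subnn muln1 (leq_trans (ltnW n8)).
have [m0 [/andP[m08 m0n] lo hi]] := least_cube_root n n8.
exists m0; split; last exact: parameters_cube_root_subepoch.
- by rewrite m0n (leq_trans _ m08).
- apply/andP; split; first by apply: leq_trans lo; rewrite leq_pmull.
  (* Since [m0 >= 3], [2 m0 <= 3 (m0 - 1)]; cube this and use the minimality of [m0]. *)
  rewrite -(leq_pmul2l (isT : 0 < 8)%N).
  apply: (@leq_trans (27 * m0.-1 ^ 3)); last by rewrite mulnCA leq_mul2l ltnW.
  rewrite -[8%N]/(2 ^ 3)%N -[27%N]/(3 ^ 3)%N -!expnMn leq_exp2r//; lia.
- have [n64|n64] := leqP n 64; first lia.
  (* Otherwise [n^3 <= 8 (m0 - 1)^3 < 64 n^2], contradicting [n > 64]. *)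
  suff : (2 * m0.-1 < n)%N by lia.
  rewrite ltnNge; apply: contraTN hi => h; rewrite -leqNgt.
  have : (n ^ 3 <= (2 * m0.-1) ^ 3)%N by rewrite leq_exp2r.
  rewrite expnMn (expnS n 2); nia.
Qed.

(** * Absolute constants and conversion to powers of [n] *)

Theorem theoremA9 (R : realType) :
  exists c1 c2 C : R, [/\ 0 < c1, c1 <= c2, 0 < C &
  forall (n : nat) (L : R), (1 <= n)%N -> 0 < L ->
  exists m0 : nat,
    [/\ (1 <= m0 <= n)%N,
        c1 * n%:R `^ (2 / 3) <= m0%:R <= c2 * n%:R `^ (2 / 3) &
    let m := n in
    let eta : R := 1 / (m0%:R * L) in
    c2^-1 / (n%:R `^ (2 / 3) * L) <= eta <= c1^-1 / (n%:R `^ (2 / 3) * L) /\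
    forall (d : nat) (f : 'I_n -> 'rV[R]_d -> R) (xphi xmin : 'rV[R]_d)
           (S : nat),
      (1 <= d)%N ->
      (forall i, smooth L (f i)) ->
      (forall x, average f xmin <= average f x) ->
      (1 <= S)%N ->
      expected_sq_gradient f xphi S m m0 eta
        <= C * (L * (average f xphi - average f xmin)
                / (S%:R * n%:R `^ (1 / 3)))
      /\
      forall eps : R, 0 < eps ->
        C * (n%:R `^ (2 / 3) * L * (average f xphi - average f xmin) / eps)
          <= S%:R * n%:R ->
        expected_sq_gradient f xphi S m m0 eta <= eps]].
Proof.
(* [1536 = 8 * 64 * 3]: 8 from the decrease [eta / 8] per iteration, 64 from the count of eligible
   iterations, 3 from [m0 <= 3 n^(2/3)]. *)
exists 1, 3, 1536; split; [exact: ltr01|by rewrite ler1n|by rewrite ltr0n|].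
move=> n L n0 L0.
have [m0 [m0n /andP[lo hi] n64 [p [B [p0 B0 hD hG]]]]] :=
  subepoch_length_exists R n n0.
exists m0; move: (m0n) => /andP[m00 m0n'].
(* In terms of the cube root [q], all real powers become polynomial: [n = q^3] and
   [n^(2/3) = q^2]. *)
set q : R := n%:R `^ (1 / 3).
have q0 : 0 < q by rewrite powR_gt0// ltr0n.
have nE : n%:R = q ^+ 3 :> R.
  rewrite /q -powR_mulrn ?powR_ge0// -powRrM (_ : 1 / 3 * 3%:R = 1) ?powRr1//.
  by field.
have q2E : n%:R `^ (2 / 3) = q ^+ 2 :> R.
  rewrite /q -powR_mulrn ?powR_ge0// -powRrM; congr (_ `^ _); by field.
rewrite q2E.
have m0R : 0 < m0%:R :> R by rewrite ltr0n.
have {}lo : q ^+ 2 <= m0%:R.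
  rewrite -(@ler_pXn2r _ 3) ?nnegrE ?exprn_ge0 ?(ltW q0)//.
  by rewrite exprAC -nE -!natrX ler_nat.
have {}hi : m0%:R <= 3 * q ^+ 2.
  rewrite -(@ler_pXn2r _ 3) ?nnegrE ?mulr_ge0 ?exprn_ge0 ?(ltW q0)//.
  by rewrite exprMn exprAC -nE -!natrX -natrM ler_nat.
split=> //; first by rewrite mul1r lo.
move=> m eta; have q20 : 0 < q ^+ 2 by rewrite exprn_gt0.
split.
  rewrite invr1 /eta !div1r -invfM mulrA !lef_pV2 ?posrE ?mulr_gt0//.
  by rewrite !ler_pM2r// hi.
move=> d f xphi xmin S d0 fL fmin S0.
have SR : 0 < S%:R :> R by rewrite ltr0n.
have Delta0 : 0 <= average f xphi - average f xmin by rewrite subr_ge0.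
have bound : expected_sq_gradient f xphi S m m0 eta
    <= 1536 * (L * (average f xphi - average f xmin) / (S%:R * q)).
  have := expected_sq_gradient_le L m0%:R^-1 p B f xphi xmin n0 L0 fL fmin _ p0
    B0 hD hG m0n S0.
  rewrite invr_gt0 m0R => /(_ isT).
  rewrite (_ : m0%:R^-1 / L = eta); last by rewrite /eta div1r invfM.
  move/le_trans; apply; move: Delta0.
  move: (_ - average f xmin) => Delta Delta0.
  have {}n64 : q ^+ 3 <= 64 * (n - m0).+1%:R by rewrite -nE -natrM ler_nat.
  have k0 : 0 < (n - m0).+1%:R :> R by [].
  move: ((n - m0).+1%:R : R) n64 k0 => k n64 k0.
  have -> : 8 * L * Delta / (m0%:R^-1 * (S%:R * k)) =
      (L * Delta / S%:R) * (8 * m0%:R / k).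
    by field; rewrite !gt_eqF.
  have -> : 1536 * (L * Delta / (S%:R * q)) = (L * Delta / S%:R) * (1536 / q).
    by field; rewrite !gt_eqF.
  rewrite ler_wpM2l ?divr_ge0 ?mulr_ge0 ?(ltW L0) ?(ltW SR)//.
  rewrite ler_pdivrMr// mulrAC ler_pdivlMr//.
  apply: (@le_trans _ _ (8 * (3 * q ^+ 2) * q)); last lra.
  by rewrite ler_wpM2r ?(ltW q0)// ler_wpM2l.
split=> // eps eps0 h; apply: (le_trans bound).
rewrite mulrA ler_pdivrMr ?mulr_gt0//.
(* The factor [q^2] turns [S q] into [S q^3], the total number of iterations. *)
rewrite -(ler_pM2r q20).
move: h; rewrite nE mulrA ler_pdivrMr//; lra.
Qed.
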